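(* Let $\Sigma=[\sigma_{hk}]$ be a $p\times p$ Hermitian positive definite complex matrix and let $\alpha=(n_1,m_1,\dots,n_p,m_p)\in\mathbb Z_{\ge0}^{2p}$. Let $N=\{h:n_h\neq0\}$, $M=\{k:m_k\neq0\}$, $S^N_h=\{k\in M:\sigma_{hk}\neq0\}$ for $h\in N$, and let $\{M_1,\dots,M_q\}$ be the partition of $M$ induced by the sets $S^N_h$. Assume that for every $r=1,\dots,q$, $$\sum_{i\in N:\ S^N_i\subset M_r} n_i=\sum_{j\in M_r} m_j .$$ Then the $\alpha$-moment of $\mathcal{CN}_p(\Sigma)$ is $$\nu(\alpha)=\sum_{a\in I(\alpha)}\Pi(\alpha,a),\qquad \Pi(\alpha,a)=\prod_{h=1}^p n_h!\,m_h!\prod_{h,k=1}^p\frac{\sigma_{hk}^{a_{hk}}}{a_{hk}!},$$ where $\sigma_{hk}^0:=1$ also when $\sigma_{hk}=0$.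
   Context: The complex normal distribution $\mathcal{CN}_p(\Sigma)$ on $\mathbb C^p\cong\mathbb R^{2p}$ has density $\varphi(z;\Sigma)=\frac{1}{\pi^p\det\Sigma}\exp(-z^*\Sigma^{-1}z)$ with respect to Lebesgue measure $dz$ on $\mathbb R^{2p}$. For a multi-index $\alpha=(n_1,m_1,\dots,n_p,m_p)\in\mathbb Z_{\ge0}^{2p}$ the $\alpha$-moment is $\nu(\alpha)=\int_{\mathbb C^p}\prod_{j=1}^p z_j^{n_j}\bar z_j^{m_j}\varphi(z;\Sigma)\,dz$; in particular $\sigma_{hk}=\nu(e_{2h-1}+e_{2k})$ (the entries of $\Sigma$). Induced partition: form the graph with vertex set $M$ in which two vertices are joined iff both belong to the same $S^N_h$ for some $h\in N$; its connected components form the partition of $M$ induced by the $S^N_h$. The set $I(\alpha)$: it is the set of vectors $a=(a_{11},\dots,a_{1p},a_{21},\dots,a_{pp})\in\mathbb Z_{\ge0}^{p^2}$ such that $l_{ij}(\alpha,a)\le a_{ij}\le L_{ij}(\alpha,a)$ for all $i,j=1,\dots,p$, where $$l_{ij}(\alpha,a)=\max\Big(0,\ \sum_{h=1}^i n_h-\sum_{h=j+1}^p m_h-\sum_{\substack{h\le i,\,k\le j\\ (h,k)\neq(i,j)}}a_{hk}\Big),\qquad L_{ij}(\alpha,a)=\min\Big(n_i-\sum_{h=1}^{j-1}a_{ih},\ m_j-\sum_{h=1}^{i-1}a_{hj}\Big).$$ (The paper writes $\wedge$ for this max and $\vee$ for this min.) *)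

(* Defs.v *)
From HB Require Import structures.
From mathcomp Require Import all_boot all_order all_algebra.
From mathcomp Require Import all_classical all_reals all_analysis.
From mathcomp Require Import complex.

Set Implicit Arguments.
Unset Strict Implicit.
Unset Printing Implicit Defensive.

Import Order.TTheory GRing.Theory Num.Theory.
Import numFieldNormedType.Exports.
Local Open Scope ring_scope.

Section Defs.
Variable R : realType.

(* iterated Lebesgue integral over the coordinates 0, ..., k-1 of x : nat -> R
   (coordinate k-1 outermost); the coordinates >= k are set to 0 and are
   irrelevant for functions depending only on the first k coordinates. *)
Fixpoint iter_integral (k : nat) (F : (nat -> R) -> R) : R :=
  match k with
  | 0 => F (fun _ => 0)
  | k'.+1 => Rintegral (@lebesgue_measure R) setT
      (fun t => iter_integral k' (fun x => F (fun i => if i == k' then t else x i)))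
  end.

Definition cvec_of (p : nat) (x : nat -> R) : 'cV[R[i]]_p :=
  \col_(j < p) (Complex (x (2 * j)%N) (x (2 * j).+1)).

Definition complex_integral (p : nat) (f : 'cV[R[i]]_p -> R[i]) : R[i] :=
  Complex (iter_integral (2 * p) (fun x => complex.Re (f (cvec_of p x))))
          (iter_integral (2 * p) (fun x => complex.Im (f (cvec_of p x)))).

Definition conjT (m n : nat) (A : 'M[R[i]]_(m, n)) : 'M[R[i]]_(n, m) :=
  (map_mx Num.conj A)^T.

Definition hermitian_pd (p : nat) (S : 'M[R[i]]_p) : Prop :=
  conjT S = S /\ forall v : 'cV[R[i]]_p, v != 0 -> 0 < (conjT v *m S *m v) 0 0.

(* density of CN_p(S) (the quadratic form z^* S^-1 z is real, we take its real part) *)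
Definition cnormal_density (p : nat) (S : 'M[R[i]]_p) (z : 'cV[R[i]]_p) : R[i] :=
  Complex (expR (- complex.Re ((conjT z *m invmx S *m z) 0 0))) 0
  / (Complex (pi ^+ p) 0 * \det S).

Definition cmoment (p : nat) (S : 'M[R[i]]_p) (n m : 'I_p -> nat) : R[i] :=
  complex_integral (fun z =>
    (\prod_(j < p) (z j 0 ^+ n j * (Num.conj (z j 0)) ^+ m j))
    * cnormal_density S z).

Definition l_bound (p : nat) (n m : 'I_p -> nat) (a : 'I_p -> 'I_p -> nat)
    (i j : 'I_p) : int :=
  Num.max 0
    (\sum_(h < p | (h <= i)%N) (n h)%:Z - \sum_(h < p | (j < h)%N) (m h)%:Z
     - \sum_(h < p) \sum_(k < p | [&& (h <= i)%N, (k <= j)%N & ((h, k) != (i, j))])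
         (a h k)%:Z).

Definition L_bound (p : nat) (n m : 'I_p -> nat) (a : 'I_p -> 'I_p -> nat)
    (i j : 'I_p) : int :=
  Num.min ((n i)%:Z - \sum_(h < p | (h < j)%N) (a i h)%:Z)
          ((m j)%:Z - \sum_(h < p | (h < i)%N) (a h j)%:Z).

Definition in_I (p : nat) (n m : 'I_p -> nat) (a : 'I_p -> 'I_p -> nat) : bool :=
  [forall i : 'I_p, forall j : 'I_p,
     (l_bound n m a i j <= (a i j)%:Z) && ((a i j)%:Z <= L_bound n m a i j)].

Definition Pi_term (p : nat) (S : 'M[R[i]]_p) (n m : 'I_p -> nat)
    (a : 'I_p -> 'I_p -> nat) : R[i] :=
  (\prod_(h < p) ((n h)`! * (m h)`!)%:R)
  * \prod_(h < p) \prod_(k < p) (S h k ^+ a h k / ((a h k)`!)%:R).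

(* sum over I(alpha): every a in I(alpha) satisfies a_hk <= n_h <= sum_h n_h,
   so I(alpha) is enumerated exactly once by bounded finite functions. *)
Definition sum_over_I (p : nat) (n m : 'I_p -> nat)
    (F : ('I_p -> 'I_p -> nat) -> R[i]) : R[i] :=
  \sum_(a : {ffun 'I_p * 'I_p -> 'I_((\sum_(h < p) n h).+1)}
        | in_I n m (fun h k => nat_of_ord (a (h, k))))
     F (fun h k => nat_of_ord (a (h, k))).

Definition Nset (p : nat) (n : 'I_p -> nat) : {set 'I_p} := [set h | n h != 0%N].
Definition Mset (p : nat) (m : 'I_p -> nat) : {set 'I_p} := [set k | m k != 0%N].
Definition SN (p : nat) (S : 'M[R[i]]_p) (m : 'I_p -> nat) (h : 'I_p) : {set 'I_p} :=
  [set k in Mset m | S h k != 0].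

Definition adjM (p : nat) (S : 'M[R[i]]_p) (n m : 'I_p -> nat) : rel 'I_p :=
  fun k k' => [exists h in Nset n, (k \in SN S m h) && (k' \in SN S m h)].

Definition block (p : nat) (S : 'M[R[i]]_p) (n m : 'I_p -> nat) (k : 'I_p)
  : {set 'I_p} := [set k' | k' \in Mset m & connect (adjM S n m) k k'].

End Defs.

(* Main.v *)
(** The triangular factorization [S = L diag(s) L^*] turns the density into a
    product of one-dimensional Gaussians through [z = L w]; as [L] is
    unitriangular, this substitution only translates each real coordinate by a
    function of the outer ones, so it is compatible with the iterated integral.
    Integrating by parts one real coordinate at a time gives the Wick recursion
    [nu(n + e_h, m) = sum_k m_k S_hk nu(n, m - e_k)], which is also satisfied by
    the sum of [Pi] over the tables with row sums [n] and column sums [m].  An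
    element of [I(alpha)] has row sums [n] and column sums at most [m]; if its
    term is nonzero, then no set [S^N_h] is empty, each one lies in exactly one
    block, and adding up the block identities gives [sum n = sum m], so that the
    column sums are [m]. *)
Require Import Defs.
From HB Require Import structures.
From mathcomp Require Import all_boot all_order all_algebra.
From mathcomp Require Import all_classical all_reals all_analysis.
From mathcomp Require Import measurable_realfun.
From mathcomp Require Import complex.
From mathcomp Require Import ring zify.
Import Order.TTheory GRing.Theory Num.Theory.
Local Open Scope ring_scope.

Section wick.
Set Implicit Arguments.
Unset Strict Implicit.
Unset Printing Implicit Defensive.
Import numFieldNormedType.Exports.
Local Open Scope classical_set_scope.
Local Open Scope ring_scope.

(** * Translation invariance of the Lebesgue integral *)

Section translation.
Context {R : realType}.
Local Notation mu := (@lebesgue_measure R).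
Variable c : R.

Let trans : measurableTypeR R -> measurableTypeR R := fun x : R => x + c.
Let mtrans : measurable_fun setT trans.
Proof. exact: measurable_funD. Qed.
Let trans_mixin := isMeasurableFun.Build _ _ _ _ _ mtrans.
Let trans_pack : {mfun measurableTypeR R >-> measurableTypeR R} :=
  HB.pack trans trans_mixin.

(** The translated measure agrees with [mu] on the half-open intervals []a, b]], and these values
    determine Lebesgue measure. *)
Lemma lebesgue_measure_translation (A : set R) : measurable A ->
  mu ((fun x => x + c) @^-1` A) = mu A.
Proof.
move=> mA; apply/esym.
apply: (@lebesgue_measure_unique R (pushforward mu trans_pack)) => // X.
move=> [[a b] _ <-] /=.
rewrite /pushforward /= (_ : _ @^-1` _ = `]a - c, b - c]%classic); last first.
  apply/seteqP; split => x /=; rewrite /trans !in_itv/=;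
   by rewrite ltrBlDr lerBrDr.
rewrite !lebesgue_measure_itv /= !lte_fin ltrD2r; case: ifP => // _.
by rewrite -!EFinD; congr EFin; ring.
Qed.

Import HBSimple HBNNSimple.

Section nnsfun_translation.
Variable h : {nnsfun measurableTypeR R >-> R}.
Let g : measurableTypeR R -> R := fun x : R => h (x + c).
Let mg : measurable_fun setT g.
Proof. exact: (measurableT_comp (measurable_funPT h) mtrans). Qed.
HB.instance Definition _ := isMeasurableFun.Build _ _ _ _ g mg.
Let fg : finite_set (range g).
Proof.
by apply: (sub_finite_set _ (fimfunP h)) => _ [x _ <-]; exists (x + c).
Qed.
HB.instance Definition _ := FiniteImage.Build _ _ g fg.
Let g0 x : 0 <= g x. Proof. exact: fun_ge0. Qed.
HB.instance Definition _ := isNonNegFun.Build _ _ g g0.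
Definition nnsfun_translation : {nnsfun measurableTypeR R >-> R} := g.
End nnsfun_translation.

End translation.

Section Rintegral_translation.
Context {R : realType}.
Local Notation mu := (@lebesgue_measure R).
Import HBSimple HBNNSimple.

Lemma sintegral_translation (c : R) (h : {nnsfun measurableTypeR R >-> R}) :
  sintegral mu (nnsfun_translation c h) = sintegral mu h.
Proof.
rewrite !sintegralET; apply: eq_fsbigr => x _.
by rewrite -[in RHS](lebesgue_measure_translation c)//;
   exact: (@measurable_funPTI _ _ (measurableTypeR R) R h).
Qed.

(** Suprema over simple functions are compared directly, so that [f] is arbitrary; signed functions
    are split into positive and negative parts. Iterated integrals can thus be shifted without
    tracking measurability. *)
Lemma integral_translation (c : R) (f : measurableTypeR R -> \bar R) :
  (\int[mu]_x f (x + c)%R = \int[mu]_x f x)%E.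
Proof.
have H (F : measurableTypeR R -> \bar R) (c' : R) : (forall x, 0 <= F x)%E ->
    (\int[mu]_x F x <= \int[mu]_x F (x + c')%R)%E.
  move=> F0; rewrite !ge0_integralTE//.
  apply: ge_ereal_sup => _ [h hF <-]; apply: ereal_sup_ubound.
  exists (nnsfun_translation c' h); first by move=> x; exact: hF.
  exact: sintegral_translation.
have E (F : measurableTypeR R -> \bar R) : (forall x, 0 <= F x)%E ->
    (\int[mu]_x F (x + c)%R = \int[mu]_x F x)%E.
  move=> F0; apply/eqP; rewrite eq_le H// andbT.
  (* The reverse inequality is the same one for the translated function and the shift [- c]. *)
  have := H (fun x : R => F (x + c)%R) (- c) (fun=> F0 _).
  by under [X in (_ <= X)%E -> _]eq_integral do rewrite subrK.
rewrite [LHS]integralE [RHS]integralE.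
rewrite -(E f^\+%E) ?funepos_ge0// -(E f^\-%E) ?funeneg_ge0//.
by congr (_ - _)%E; apply: eq_integral => x _; rewrite ?funeposE ?funenegE.
Qed.

Lemma Rintegral_translation (c : R) (f : R -> R) :
  Rintegral mu setT (fun x => f (x + c)) = Rintegral mu setT f.
Proof. by rewrite /Rintegral (integral_translation c (EFin \o f)). Qed.

End Rintegral_translation.

(** * Gaussian moments on the line *)

Section gaussian_moments.
Context {R : realType}.
Local Notation mu := (@lebesgue_measure R).
Implicit Types (d t : R) (e : nat).

Definition mono_gauss d e t : R := t ^+ e * expR (- (d * t ^+ 2)).

(** With [s = d * t ^+ 2], the exponential series gives [exp s >= 1 + s^(e+1) / (e+1)!], while
    [|t|^e <= 1 + t^(2(e+1))]; the constant adds the bounds of these two summands. *)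
Lemma mono_gauss_bound d e : 0 < d -> exists2 C, 0 <= C & forall t, `|mono_gauss d e t| <= C.
Proof.
move=> d0; exists (1 + e.+1`!%:R / d ^+ e.+1).
  by rewrite addr_ge0// divr_ge0// exprn_ge0// ltW.
move=> t; rewrite /mono_gauss normrM (ger0_norm (expR_ge0 _)) expRN ler_pdivrMr ?expR_gt0//.
have s0 : 0 <= d * t ^+ 2 by rewrite mulr_ge0 ?sqr_ge0// ltW.
have := expR_ge1Dxn e s0; set E := expR _ => hE.
have E0 : 0 < E by exact: expR_gt0.
have E1 : 1 <= E.
  by apply: le_trans hE; rewrite lerDl divr_ge0// exprn_ge0.
have hs : (t ^+ 2) ^+ e.+1 <= e.+1`!%:R / d ^+ e.+1 * E.
  rewrite mulrAC ler_pdivlMr ?exprn_gt0// -exprMn [_ * d]mulrC.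
  rewrite -ler_pdivrMl ?ltr0n ?fact_gt0//.
  by apply: le_trans hE; rewrite [leLHS]mulrC ler_wpDl.
rewrite mulrDl mul1r; apply: le_trans (lerD E1 hs).
rewrite normrX -exprM.
have [t1|t1] := leP `|t| 1.
  rewrite ler_wpDr//; last by rewrite exprn_ile1.
  by rewrite exprM exprn_ge0// sqr_ge0.
rewrite ler_wpDl// -(@ger0_norm _ (t ^+ _)) ?normrX; last first.
  by rewrite exprM exprn_ge0// sqr_ge0.
by apply: ler_weXn2l; [exact: ltW|lia].
Qed.

Lemma continuous_mono_gauss d e : continuous (mono_gauss d e).
Proof.
move=> t; apply: cvgM; first exact: exprn_continuous.
apply: continuous_comp; last exact: continuous_expR.
apply: cvgN; apply: cvgM; first exact: cvg_cst.
exact: exprn_continuous.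
Qed.

Lemma measurable_mono_gauss d e : measurable_fun [set: R] (mono_gauss d e).
Proof. by apply: continuous_measurable_fun; exact: continuous_mono_gauss. Qed.

(** Up to a constant this is the normal density of variance [1 / (2 d)], whose integrability and
    total mass are known. *)
Lemma mono_gauss0_normal d : 0 < d ->
  mono_gauss d 0 = fun t => Num.sqrt (pi / d) * normal_pdf 0 (Num.sqrt (2 * d)^-1) t.
Proof.
move=> d0; apply/funext => t.
have v0 : 0 < (2 * d)^-1 by rewrite invr_gt0 mulr_gt0.
have s0 : Num.sqrt (2 * d)^-1 != 0 by rewrite gt_eqF// sqrtr_gt0.
rewrite normal_pdfE// /normal_peak /normal_fun sqr_sqrtr ?ltW//.
rewrite (_ : (2 * d)^-1 * pi *+ 2 = pi / d); last first.
  by rewrite -mulr_natl; field; rewrite gt_eqF.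
rewrite mulrA divff ?mul1r; last first.
  by rewrite gt_eqF// sqrtr_gt0 divr_gt0// pi_gt0.
rewrite /mono_gauss expr0 mul1r subr0; congr expR.
by rewrite -mulr_natl; field; rewrite gt_eqF.
Qed.

Lemma integrable_mono_gauss d e : 0 < d -> mu.-integrable setT (EFin \o mono_gauss d e).
Proof.
(* Half of the exponent absorbs the power [t ^+ e] into a bounded factor; the other half is an
   integrable majorant. *)
move=> d0; have d20 : 0 < d / 2 by rewrite divr_gt0.
have [C C0 hC] := mono_gauss_bound e d20.
apply: (@le_integrable _ _ _ mu setT measurableT _
  (fun t => (C * mono_gauss (d / 2) 0 t)%:E)).
- by apply/measurable_EFinP; exact: measurable_mono_gauss.
- move=> t _; rewrite /= lee_fin.
  rewrite [leRHS]ger0_norm; last by rewrite mulr_ge0// mulr_ge0 ?expR_ge0.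
  have -> : mono_gauss d e t = mono_gauss (d / 2) e t * mono_gauss (d / 2) 0 t.
    rewrite /mono_gauss expr0 mul1r -mulrA -expRD; congr (_ * expR _).
    by field.
  rewrite normrM (@ger0_norm _ (mono_gauss _ 0 _)) ?ler_wpM2r//;
    by rewrite mulr_ge0 ?expR_ge0.
- rewrite mono_gauss0_normal//.
  have := integrableZl measurableT (C * Num.sqrt (pi / (d / 2)))
    (integrable_normal_pdf 0 (Num.sqrt (2 * (d / 2))^-1)).
  by under eq_fun do rewrite -EFinM -mulrA.
Qed.

Lemma Rintegral_mono_gauss0 d : 0 < d ->
  Rintegral mu setT (mono_gauss d 0) = Num.sqrt (pi / d).
Proof.
move=> d0; rewrite mono_gauss0_normal// RintegralZl//; last exact: integrable_normal_pdf.
by rewrite /Rintegral integral_normal_pdf /= mulr1.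
Qed.


(** At [e = 0] the predecessor [e.-1] is again [0], which is harmless because its coefficient [e%:R]
    vanishes. *)
Lemma is_derive_mono_gauss d e t : is_derive t 1 (mono_gauss d e)
  (e%:R * mono_gauss d e.-1 t - 2 * d * mono_gauss d e.+1 t).
Proof.
have dX n : is_derive t 1 (fun t : R => t ^+ n) (n%:R * t ^+ n.-1).
  have := is_deriveX n (is_derive_id t (1 : R)); rewrite exprfctE.
  by rewrite /GRing.scale /= mulr1.
have dE : is_derive t 1 (fun t => expR (- (d * t ^+ 2)))
    (- (d * (2 * t)) * expR (- (d * t ^+ 2))).
  have h : is_derive t 1 (fun t : R => - (d * t ^+ 2)) (- (d * (2 * t))).
    have -> : - (d * (2 * t)) = - (d *: (2%:R * t ^+ 2.-1)) by rewrite /= expr1.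
    exact: (is_deriveN (is_deriveZ d (dX 2))).
  rewrite mulrC; exact: (is_derive1_comp (is_derive_expR _) h).
rewrite [X in is_derive _ _ _ X](_ : _ = t ^+ e *: (- (d * (2 * t)) *
  expR (- (d * t ^+ 2))) + expR (- (d * t ^+ 2)) *: (e%:R * t ^+ e.-1)).
  exact: (is_deriveM (dX e) dE).
rewrite /mono_gauss /GRing.scale /= [t ^+ e.+1]exprS; move: (expR _) => E; ring.
Qed.

(** These are the boundary terms of the integration by parts; the bound for degree [e + 1] gives a
    decay like [C / |t|]. *)
Lemma mono_gauss_cvg0 d e : 0 < d ->
  (mono_gauss d e n.+1%:R - mono_gauss d e (- n.+1%:R)) @[n --> \oo] --> (0 : R).
Proof.
move=> d0; have [C C0 hC] := mono_gauss_bound e.+1 d0.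
have h t : 0 < `|t| -> `|mono_gauss d e t| <= C / `|t|.
  move=> t0; rewrite ler_pdivlMr// -normrM; have := hC t.
  by rewrite /mono_gauss exprS -mulrA mulrC.
have hn n : `|mono_gauss d e n.+1%:R - mono_gauss d e (- n.+1%:R)| <= 2 * C * harmonic n.
  apply: le_trans (ler_normB _ _) _.
  have n0 : 0 < n.+1%:R :> R by rewrite ltr0n.
  have n0' : `|n.+1%:R| = n.+1%:R :> R by rewrite ger0_norm// ltW.
  have h1 := h n.+1%:R; have h2 := h (- n.+1%:R).
  rewrite normrN !n0' in h1 h2.
  by rewrite -mulrA mulrDl mul1r lerD ?h1 ?h2.
apply: (@squeeze_cvgr _ _ _ _ (fun n => - (2 * C * harmonic n))
    (fun n => 2 * C * harmonic n)).
- by apply: nearW => n; rewrite -ler_norml.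
- rewrite -[X in _ --> X]oppr0 -[X in - X](mulr0 (2 * C)).
  by apply: cvgN; apply: cvgM; [exact: cvg_cst|exact: cvg_harmonic].
- rewrite -[X in _ --> X](mulr0 (2 * C)).
  by apply: cvgM; [exact: cvg_cst|exact: cvg_harmonic].
Qed.

(** Integration by parts: the derivative of [mono_gauss d e] integrates to [0] over the line, and
    its two terms give the recursion. *)
Lemma Rintegral_mono_gaussS d e : 0 < d ->
  Rintegral mu setT (mono_gauss d e.+1) =
  e%:R / (2 * d) * Rintegral mu setT (mono_gauss d e.-1).
Proof.
move=> d0.
pose f t := e%:R * mono_gauss d e.-1 t - 2 * d * mono_gauss d e.+1 t.
have i1 := integrableZl measurableT e%:R (integrable_mono_gauss e.-1 d0).
have i2 := integrableZl measurableT (2 * d) (integrable_mono_gauss e.+1 d0).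
have intf : mu.-integrable setT (EFin \o f).
  exact: (integrableB measurableT i1 i2).
have cf : continuous f.
  by move=> t; apply: cvgB; apply: cvgM; try exact: cvg_cst; exact: continuous_mono_gauss.
have mf : measurable_fun [set: R] f by exact: continuous_measurable_fun.
pose I n := `[- n.+1%:R, n.+1%:R]%classic : set R.
have ftc n : (\int[mu]_(x in I n) (f x)%:E =
    (mono_gauss d e n.+1%:R - mono_gauss d e (- n.+1%:R))%:E)%E.
  rewrite EFinB; apply: continuous_FTC2.
  - by rewrite gtrN// ltr0n.
  - exact: continuous_subspaceT.
  - split.
    + by move=> t _; case: (is_derive_mono_gauss d e t).
    + by apply: cvg_at_right_filter; exact: continuous_mono_gauss.
    + by apply: cvg_at_left_filter; exact: continuous_mono_gauss.
  - by move=> t _; rewrite derive1E; case: (is_derive_mono_gauss d e t).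
(* The integrals over the growing intervals [I n] converge to the full one by dominated convergence
   with majorant [|f|], and they equal the vanishing boundary terms. *)
have f0 : Rintegral mu setT f = 0.
  have := @dominated_convergence _ _ _ mu setT measurableT
    (fun n => EFin \o (f \_ (I n))) (EFin \o f) (abse \o (EFin \o f)).
  case.
  - move=> n; apply/measurable_EFinP.
    by apply: (measurable_restrictT f (measurable_itv _)).1; exact: measurable_funTS.
  - exact/measurable_EFinP.
  - apply: aeW => t _; apply: cvg_near_cst.
    near=> n; rewrite /= patchE mem_set //; rewrite /I /= in_itv /= -ler_norml.
    rewrite (@le_trans _ _ n%:R)// ?ler_nat//; apply: ltW.
    by near: n; exact: nbhs_infty_gtr.
  - exact: integrable_abse.
  - apply: aeW => t n _; rewrite /= lee_fin patchE; case: ifP => // _.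
    by rewrite normr0.
  move=> _ _ h.
  have {}h : (\int[mu]_(x in I n) (f x)%:E)%E @[n --> \oo] --> (\int[mu]_x (f x)%:E)%E.
    rewrite (_ : (fun n => _) = (fun n => \int[mu]_x (EFin \o f \_ (I n)) x)%E)//.
    by apply/funext => n; rewrite integral_mkcond restrict_EFin.
  have E : (\int[mu]_x (f x)%:E)%E = (Rintegral mu setT f)%:E.
    by rewrite /Rintegral fineK//; exact: integrable_fin_num.
  rewrite E in h.
  have {}h : (fine \o (fun n => \int[mu]_(x in I n) (f x)%:E)%E) n @[n --> \oo]
      --> Rintegral mu setT f by exact: fine_cvg.
  rewrite -(cvg_lim (@Rhausdorff R) h); apply/cvg_lim; first exact: Rhausdorff.
  rewrite (_ : fine \o _ =
    (fun n => mono_gauss d e n.+1%:R - mono_gauss d e (- n.+1%:R)));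
    first exact: mono_gauss_cvg0.
  by apply/funext => n /=; rewrite ftc.
have : e%:R * Rintegral mu setT (mono_gauss d e.-1) -
    2 * d * Rintegral mu setT (mono_gauss d e.+1) = 0.
  rewrite -f0 RintegralB//; first by rewrite !RintegralZl//; exact: integrable_mono_gauss.
move/eqP; rewrite subr_eq0 => /eqP h; apply: (@mulfI _ (2 * d)).
  by rewrite gt_eqF// mulr_gt0.
by rewrite -h mulrA; congr (_ * _); field; rewrite gt_eqF.
Unshelve. all: by end_near. Qed.

End gaussian_moments.

(** * Iterated integrals *)

Section iterated_integrals.
Context {R : realType}.
Local Notation mu := (@lebesgue_measure R).
Implicit Types (F G : (nat -> R) -> R).

Definition upd k (t : R) (x : nat -> R) i := if i == k then t else x i.

Lemma iter_integralS k F : iter_integral k.+1 F =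
  Rintegral mu setT (fun t => iter_integral k (F \o upd k t)).
Proof. by []. Qed.

(** Integrability is required for every value of the outer coordinates, not just almost everywhere,
    so that linearity passes through all levels pointwise. *)
Fixpoint iter_integrable k F : Prop :=
  if k is k'.+1 then (forall t, iter_integrable k' (F \o upd k' t)) /\
    mu.-integrable setT (EFin \o (fun t => iter_integral k' (F \o upd k' t)))
  else True.

Lemma iter_linear k F G a b : iter_integrable k F -> iter_integrable k G ->
  iter_integrable k (fun x => a * F x + b * G x) /\
  iter_integral k (fun x => a * F x + b * G x) =
    a * iter_integral k F + b * iter_integral k G.
Proof.
elim: k F G => [//|k IH] F G [iF intF] [iG intG].
have H t := IH _ _ (iF t) (iG t).
have E : (fun t => iter_integral k ((fun x => a * F x + b * G x) \o upd k t)) =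
    (fun t => a * iter_integral k (F \o upd k t) + b * iter_integral k (G \o upd k t)).
  by apply/funext => t; case: (H t).
have iaF := integrableZl measurableT a intF.
have ibG := integrableZl measurableT b intG.
split; first split.
- by move=> t; case: (H t).
- rewrite E; exact: (integrableD measurableT iaF ibG).
- rewrite !iter_integralS E RintegralD//.
  by rewrite !RintegralZl.
Qed.

Lemma iter_prod k (f : nat -> R -> R) :
  (forall i, (i < k)%N -> mu.-integrable setT (EFin \o f i)) ->
  iter_integrable k (fun x : nat -> R => \prod_(i < k) f i (x i)) /\
  iter_integral k (fun x : nat -> R => \prod_(i < k) f i (x i)) =
    \prod_(i < k) Rintegral mu setT (f i).
Proof.
elim: k => [_|k IH hf]; first by split=> //=; rewrite !big_ord0.
have [iF EF] := IH (fun i ik => hf i (ltnW ik)).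
have E t : (fun x : nat -> R => \prod_(i < k.+1) f i (x i)) \o upd k t =
    (fun x : nat -> R => f k t * (\prod_(i < k) f i (x i)) + 0 * (\prod_(i < k) f i (x i))).
  apply/funext => x /=; rewrite mul0r addr0 big_ord_recr /= mulrC /upd eqxx.
  by congr (_ * _); apply: eq_bigr => i _; rewrite ltn_eqF.
have H t := iter_linear (f k t) 0 iF iF.
have Ev : (fun t => iter_integral k
    ((fun x : nat -> R => \prod_(i < k.+1) f i (x i)) \o upd k t))
   = (fun t => (\prod_(i < k) Rintegral mu setT (f i)) * f k t).
  by apply/funext => t; rewrite E; have [_ ->] := H t; rewrite EF mul0r addr0 mulrC.
split; first split.
- by move=> t; rewrite E; case: (H t).
- by rewrite Ev; exact: (integrableZl measurableT _ (hf k (ltnSn k))).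
- by rewrite iter_integralS Ev RintegralZl// ?big_ord_recr//; exact: hf.
Qed.

(* The shift of the outermost coordinate is constant, and once that coordinate
   is fixed the remaining shifts satisfy the hypothesis one level down. *)
Lemma iter_shift k (s : nat -> (nat -> R) -> R) F :
  (forall i x y, (forall j, (i < j < k)%N -> x j = y j) -> s i x = s i y) ->
  iter_integral k (fun x => F (fun i => if (i < k)%N then x i + s i x else x i)) =
  iter_integral k F.
Proof.
elim: k s F => [|k IH] s F hs; first by congr F; apply/funext.
pose c := s k (fun=> 0).
pose g t := iter_integral k (F \o upd k t).
rewrite !iter_integralS -[RHS](Rintegral_translation c g).
apply: eq_Rintegral => t _; rewrite /g.
rewrite -[RHS](IH (fun i x => s i (upd k t x))).
  congr iter_integral; apply/funext => x /=; congr F; apply/funext => i.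
  rewrite /upd; have [->|ik] := eqVneq i k.
    by rewrite ltnSn; congr (_ + _); apply: hs => j; lia.
  by rewrite ltnS leq_eqVlt (negbTE ik).
move=> i x y xy; apply: hs => j ijk; rewrite /upd; case: eqP => // /eqP jk.
by apply: xy; lia.
Qed.

End iterated_integrals.

(** * Triangular factorization *)

Section ldl.
Context {R : realType}.
Local Notation C := R[i].

Lemma conjT_mul m n q (A : 'M[C]_(m, n)) (B : 'M[C]_(n, q)) :
  conjT (A *m B) = conjT B *m conjT A.
Proof. by rewrite /conjT map_mxM trmx_mul. Qed.

Lemma conjTK m n (A : 'M[C]_(m, n)) : conjT (conjT A) = A.
Proof. by apply/matrixP => i j; rewrite !mxE conjCK. Qed.

Lemma conjT_block m1 m2 n1 n2 (A : 'M[C]_(m1, n1)) B D (E : 'M[C]_(m2, n2)) :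
  conjT (block_mx A B D E) = block_mx (conjT A) (conjT D) (conjT B) (conjT E).
Proof. by rewrite /conjT map_block_mx tr_block_mx. Qed.

Lemma conjT_col m1 m2 n (A : 'M[C]_(m1, n)) (B : 'M[C]_(m2, n)) :
  conjT (col_mx A B) = row_mx (conjT A) (conjT B).
Proof. by rewrite /conjT map_col_mx tr_col_mx. Qed.

Lemma conjTZ m n a (A : 'M[C]_(m, n)) : conjT (a *: A) = Num.conj a *: conjT A.
Proof. by apply/matrixP => i j; rewrite !mxE rmorphM. Qed.

Lemma conjTB m n (A B : 'M[C]_(m, n)) : conjT (A - B) = conjT A - conjT B.
Proof. by apply/matrixP => i j; rewrite !mxE rmorphB. Qed.

Lemma conjT0 m n : conjT (0 : 'M[C]_(m, n)) = 0.
Proof. by apply/matrixP => i j; rewrite !mxE conjC0. Qed.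

Lemma conjT1 n : conjT (1%:M : 'M[C]_n) = 1%:M.
Proof. by apply/matrixP => i j; rewrite !mxE eq_sym rmorph_nat. Qed.

Lemma conj_gt0 (g : C) : 0 < g -> Num.conj g = g.
Proof. by move=> g0; apply/CrealP; rewrite realE ltW. Qed.

Lemma gt0_complexE (g : C) : 0 < g -> g = (complex.Re g)%:C%C.
Proof. by case: g => a b; rewrite ltcE /= => /andP[/eqP h _]; rewrite h. Qed.

(** Induction splitting off the last row and column: the Schur complement of the corner entry [g] is
    again Hermitian positive definite. [L] is made upper triangular because the last coordinates are
    integrated outermost. *)
Lemma hermitian_pd_ldl p (S : 'M[C]_p) : hermitian_pd S ->
  exists (L : 'M[C]_p) (s : 'rV[R]_p),
    [/\ forall i, 0 < s 0 i,
        forall i j : 'I_p, (j < i)%N -> L i j = 0,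
        forall i, L i i = 1 &
        S = L *m diag_mx (map_mx (real_complex R) s) *m conjT L].
Proof.
elim: p S => [|p IH].
  move=> S _; exists 1%:M, 0; split; try by case.
  by apply/matrixP; case.
rewrite -addn1 => S [hS pS].
pose A := ulsubmx S; pose b := ursubmx S; pose g := drsubmx S 0 0.
have ES : S = block_mx A b (conjT b) g%:M.
  rewrite -[LHS]submxK -/A -/b; congr block_mx.
    by rewrite -[in LHS]hS /conjT /b map_ursubmx trmx_ursub.
  by rewrite [LHS]mx11_scalar.
have hA : conjT A = A.
  have := hS; rewrite ES conjT_block => /eq_block_mx; by case.
have g0 : 0 < g.
  have := pS (col_mx 0 1%:M).
  rewrite ES conjT_col mul_row_block mul_row_col mulmx0 add0r.
  rewrite mulmx1 conjT0 conjT1 mul0mx add0r mul1mx.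
  rewrite mxE eqxx mulr1n; apply.
  apply/eqP => /(congr1 (fun v => dsubmx v 0 0)) /eqP.
  by rewrite col_mxKd !mxE eqxx oner_eq0.
have cgV : Num.conj g^-1 = g^-1 by apply: conj_gt0; rewrite invr_gt0.
have g_neq0 : g != 0 by rewrite gt_eqF.
pose A' := A - g^-1 *: (b *m conjT b).
have [|L' [s' [s0 tL dL EA]]] := IH A'.
  split.
    by rewrite conjTB hA conjTZ conjT_mul conjTK cgV.
  (* The lower component is chosen so that [S] times this vector has last entry [0]; the form of [S]
     there is then the form of [A'] at [v]. *)
  move=> v v0; have := pS (col_mx v (- g^-1 *: (conjT b *m v))).
  have -> : col_mx v (- g^-1 *: (conjT b *m v)) != 0.
    by apply: contra v0; rewrite col_mx_eq0 => /andP[].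
  move=> /(_ isT); congr (0 < _ 0 0).
  rewrite ES conjT_col mul_row_block mul_row_col conjTZ conjT_mul conjTK.
  rewrite rmorphN /= cgV /A'.
  rewrite !mul_mx_scalar -!scalemxAl -!scalemxAr !scalerA.
  rewrite mulrN divff// scaleN1r subrr mul0mx scaler0 addr0.
  by rewrite mulmxBr -scalemxAr mulmxA scaleNr.
exists (block_mx L' (g^-1 *: b) 0 1%:M), (row_mx s' (complex.Re g)%:M).
split.
- move=> i; case: (split_ordP i) => j ->; rewrite ?row_mxEl ?row_mxEr//.
  by rewrite !mxE ord1 eqxx mulr1n; move: g0; rewrite ltcE => /andP[].
- move=> i j; case: (split_ordP i) => i' ->; case: (split_ordP j) => j' -> /=.
  + by rewrite block_mxEul; exact: tL.
  + by move=> h; exfalso; move: h (ltn_ord i'); lia.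
  + by rewrite block_mxEdl mxE.
  + by rewrite !ord1 ltnn.
- move=> i; case: (split_ordP i) => j ->.
  + by rewrite block_mxEul.
  + by rewrite block_mxEdr mxE !ord1.
- rewrite map_row_mx diag_mx_row.
  have -> : diag_mx (map_mx (real_complex R) (complex.Re g)%:M) = (g%:M : 'M[C]_1).
    by apply/matrixP => i j; rewrite !mxE !ord1 eqxx !mulr1n -gt0_complexE.
  rewrite conjT_block conjT0 conjT1 conjTZ cgV !mulmx_block.
  rewrite !mulmx0 !mul0mx !mulmx1 !mul1mx !addr0 !add0r -EA ES /A'.
  rewrite mul_mx_scalar mul_scalar_mx !scalerA divff// !scale1r.
  by rewrite -scalemxAr subrK mul0mx add0r.
Qed.

End ldl.

(** * Contingency tables *)

Section multiplicities.
Context {T : finType}.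
Implicit Types (c : T -> nat) (s t : T).

Definition incr c t u := (c u + (u == t))%N.
Definition decr c t u := (c u - (u == t))%N.

Lemma incrC c s t : incr (incr c s) t = incr (incr c t) s.
Proof. by apply/funext => u; rewrite /incr addnAC. Qed.

Lemma decr_incr c t : decr (incr c t) t = c.
Proof. by apply/funext => u; rewrite /incr /decr addnK. Qed.

Lemma incr_decr c t : (0 < c t)%N -> incr (decr c t) t = c.
Proof.
by move=> ct; apply/funext => u; rewrite /incr /decr subnK//; case: eqP => // ->.
Qed.

Lemma sum_incr c t : (\sum_u incr c t u = (\sum_u c u).+1)%N.
Proof.
rewrite /incr big_split /= -addn1; congr addn.
by rewrite (bigD1 t)//= eqxx big1// => u /negPf ->.
Qed.

Lemma multiplicity_ind (P : (T -> nat) -> Prop) :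
  P (fun=> 0%N) -> (forall c t, P c -> P (incr c t)) -> forall c, P c.
Proof.
move=> P0 PS c; have [N] := ubnP (\sum_t c t)%N.
elim: N c => // N IH c cN.
have [/forallP c0|/forallPn[t]] := boolP [forall t, c t == 0%N].
  by rewrite (_ : c = fun=> 0%N)//; apply/funext => t; exact/eqP.
rewrite -lt0n => ct; rewrite -(incr_decr ct); apply/PS/IH.
by move: cN; rewrite -{1}(incr_decr ct) sum_incr.
Qed.

(** Leibniz rule in terms of exponents: it differentiates [x_s * x^c] with respect to [x_t], with
    [g c] in the place of [x^c]. Where the subtraction truncates, its coefficient [c t] is [0]. *)
Lemma decr_incr_split (K : pzRingType) (g : (T -> nat) -> K) c s t :
  (incr c s t)%:R * g (decr (incr c s) t) =
  (c t)%:R * g (incr (decr c t) s) + (t == s)%:R * g c.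
Proof.
rewrite /incr natrD mulrDl; congr (_ + _); last first.
  by case: eqP => [->|_]; rewrite ?mul0r// (decr_incr c s).
have [->|ct] := posnP (c t); first by rewrite !mul0r.
congr (_ * g _); apply/funext => u; rewrite /decr.
by case: (eqVneq u t) => [->|_]; lia.
Qed.

End multiplicities.

(** * Weighted sums over tables with prescribed margins *)

Section tables.
Context {K : numFieldType} {p : nat}.
Variables (sigma : 'I_p -> 'I_p -> K) (B : nat).
Implicit Types (n m : 'I_p -> nat).
Local Notation table := {ffun 'I_p * 'I_p -> 'I_B.+1}.
Implicit Types (a : table).

Definition has_rows n a := [forall h, \sum_k (a (h, k) : nat) == n h]%N.
Definition has_cols m a := [forall k, \sum_h (a (h, k) : nat) == m k]%N.
Definition weight a : K :=
  \prod_h \prod_k (sigma h k ^+ a (h, k) / (a (h, k))`!%:R).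
Definition table_sum n m : K :=
  \sum_(a | has_rows n a && has_cols m a) weight a.

(** [inord] keeps the entries in the finite type, so this is a true increment only when the entry of
    the cell is below [B]. *)
Definition incr_cell (x : 'I_p * 'I_p) a : table :=
  [ffun y => inord (a y + (y == x))%N].
Definition decr_cell (x : 'I_p * 'I_p) a : table :=
  [ffun y => inord (a y - (y == x))%N].

Lemma decr_cellE x a y : decr_cell x a y = (a y - (y == x))%N :> nat.
Proof. by rewrite ffunE inordK// ltnS (leq_trans (leq_subr _ _))// -ltnS. Qed.

Lemma incr_cellE x a y : (a x < B)%N ->
  incr_cell x a y = (a y + (y == x))%N :> nat.
Proof.
move=> ax; rewrite ffunE inordK//; case: eqP => [->|_]; first by rewrite addn1.
by rewrite addn0.
Qed.

Lemma incr_decr_cell x a : (0 < a x)%N -> incr_cell x (decr_cell x a) = a.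
Proof.
move=> ax; have dx : (decr_cell x a x < B)%N.
  by rewrite decr_cellE eqxx; have := ltn_ord (a x); lia.
apply/ffunP => y; apply: val_inj => /=.
by rewrite incr_cellE// decr_cellE; case: eqP => [->|_]; lia.
Qed.

Lemma decr_incr_cell x a : (a x < B)%N -> decr_cell x (incr_cell x a) = a.
Proof.
move=> ax; apply/ffunP => y; apply: val_inj => /=.
by rewrite decr_cellE incr_cellE// addnK.
Qed.

Lemma sum_row_incr h0 k0 a h : (a (h0, k0) < B)%N ->
  (\sum_k (incr_cell (h0, k0) a (h, k) : nat) =
   incr (fun i => \sum_k (a (i, k) : nat)) h0 h)%N.
Proof.
move=> ax; under eq_bigr do rewrite incr_cellE//.
rewrite /incr big_split /=; congr addn; under eq_bigr do rewrite xpair_eqE.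
case: (h == h0); last by rewrite big1.
by rewrite (bigD1 k0)//= eqxx big1 ?addn0// => k /negPf ->.
Qed.

Lemma sum_col_incr h0 k0 a k : (a (h0, k0) < B)%N ->
  (\sum_h (incr_cell (h0, k0) a (h, k) : nat) =
   incr (fun i => \sum_h (a (h, i) : nat)) k0 k)%N.
Proof.
move=> ax; under eq_bigr do rewrite incr_cellE//.
rewrite /incr big_split /=; congr addn; under eq_bigr do rewrite xpair_eqE.
case: (k == k0); last by rewrite big1// => i _; rewrite andbF.
by rewrite (bigD1 h0)//= eqxx big1 ?addn0// => i /negPf ->.
Qed.

(** In the chosen cell [(a + 1) / (a + 1)! = 1 / a!] and one factor [sigma h0 k0] splits off; the
    other cells do not change. *)
Lemma weight_incr h0 k0 a : (a (h0, k0) < B)%N ->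
  (a (h0, k0)).+1%:R * weight (incr_cell (h0, k0) a) = sigma h0 k0 * weight a.
Proof.
move=> ax; rewrite /weight.
rewrite (bigD1 h0)//= (bigD1 k0)//= incr_cellE// eqxx addn1.
rewrite [in RHS](bigD1 h0)//= [in RHS](bigD1 k0)//=.
have -> : \prod_(i | i != k0) (sigma h0 i ^+ incr_cell (h0, k0) a (h0, i) /
      (incr_cell (h0, k0) a (h0, i))`!%:R) =
    \prod_(i | i != k0) (sigma h0 i ^+ a (h0, i) / (a (h0, i))`!%:R).
  apply: eq_bigr => i ik; rewrite !incr_cellE//.
  by rewrite xpair_eqE (negPf ik) andbF addn0.
have -> : \prod_(i | i != h0) \prod_k (sigma i k ^+ incr_cell (h0, k0) a (i, k) /
      (incr_cell (h0, k0) a (i, k))`!%:R) =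
    \prod_(i | i != h0) \prod_k (sigma i k ^+ a (i, k) / (a (i, k))`!%:R).
  apply: eq_bigr => i ik; apply: eq_bigr => k _; rewrite !incr_cellE//.
  by rewrite xpair_eqE (negPf ik) addn0.
rewrite !mulrA; do 2 congr (_ * _).
rewrite exprS factS natrM; field.
by rewrite nat1r !pnatr_eq0 -!lt0n fact_gt0.
Qed.

Lemma leq_row n a h k : has_rows n a -> (a (h, k) <= \sum_i n i)%N.
Proof.
move=> /forallP/(_ h)/eqP ha.
by rewrite (bigD1 h)//= -ha (bigD1 k)//= -addnA leq_addr.
Qed.

(** Tables with a zero in the cell contribute nothing; on the others, removing one unit from the
    cell is a bijection onto the tables with margins [n] and [decr m k0]. The bound on [\sum_i n i]
    leaves room to put the unit back. *)
Lemma table_sum_cell n m h0 k0 : (\sum_i n i < B)%N ->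
  \sum_(a | has_rows (incr n h0) a && has_cols m a) (a (h0, k0))%:R * weight a =
  if (0 < m k0)%N then sigma h0 k0 * table_sum n (decr m k0) else 0.
Proof.
move=> nB; case: ifPn => [mk|]; last first.
  rewrite -eqn0Ngt => /eqP mk; apply: big1 => a /andP[_ /forallP/(_ k0)].
  rewrite mk sum_nat_eq0 => /forallP/(_ h0)/= /eqP ->.
  by rewrite mul0r.
rewrite (bigID (fun a => (0 < a (h0, k0))%N)) /= [X in _ + X]big1 ?addr0; last first.
  by move=> a /andP[_]; rewrite -eqn0Ngt => /eqP ->; rewrite mul0r.
rewrite (reindex_onto (incr_cell (h0, k0)) (decr_cell (h0, k0))); last first.
  by move=> a /andP[_]; exact: incr_decr_cell.
rewrite /table_sum mulr_sumr; apply: eq_big => a; last first.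
  move=> /andP[/andP[_ a0] /eqP Ea].
  have aB : (a (h0, k0) < B)%N.
    rewrite -Ea decr_cellE eqxx.
    by have := ltn_ord (incr_cell (h0, k0) a (h0, k0)); lia.
  by rewrite -weight_incr// incr_cellE// eqxx addn1.
apply/idP/idP.
  move=> /andP[/andP[/andP[ra ca] a0] /eqP Ea].
  have aB : (a (h0, k0) < B)%N.
    rewrite -Ea decr_cellE eqxx.
    by have := ltn_ord (incr_cell (h0, k0) a (h0, k0)); lia.
  apply/andP; split; apply/forallP => i.
    by have /forallP/(_ i) := ra; rewrite sum_row_incr// /incr eqn_add2r.
  have /forallP/(_ i) := ca; rewrite sum_col_incr// /incr /decr => /eqP <-.
  by rewrite addnK.
move=> /andP[ra ca].
have aB : (a (h0, k0) < B)%N by apply: leq_ltn_trans nB; exact: leq_row.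
rewrite decr_incr_cell// eqxx incr_cellE// eqxx addn1 !andbT.
apply/andP; split; apply/forallP => i.
  by rewrite sum_row_incr// /incr (eqP (forallP ra i)).
rewrite sum_col_incr// /incr (eqP (forallP ca i)) /decr.
by rewrite subnK//; case: eqP => // ->.
Qed.

(** The factor [(n h0).+1] is the sum of row [h0]; distributing it over the cells of that row gives
    the counterpart of the Wick recursion. *)
Lemma table_sum_incr n m h0 : (\sum_i n i < B)%N ->
  (n h0).+1%:R * table_sum (incr n h0) m =
  \sum_(k | (0 < m k)%N) sigma h0 k * table_sum n (decr m k).
Proof.
move=> nB; rewrite /table_sum mulr_sumr.
transitivity (\sum_k \sum_(a | has_rows (incr n h0) a && has_cols m a)
    (a (h0, k))%:R * weight a).
  rewrite exchange_big; apply: eq_bigr => a /andP[/forallP/(_ h0)/eqP ra _].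
  by rewrite -mulr_suml -natr_sum ra /incr eqxx addn1.
rewrite [RHS]big_mkcond; apply: eq_bigr => k _.
by rewrite table_sum_cell.
Qed.

Lemma table_sum0 m : table_sum (fun=> 0%N) m = (if [forall k, m k == 0%N] then 1 else 0).
Proof.
have r0 : has_rows (fun=> 0%N) [ffun=> ord0].
  by apply/forallP => h; apply/eqP; apply: big1 => k _; rewrite ffunE.
have ra a : has_rows (fun=> 0%N) a -> a = [ffun=> ord0].
  move=> /forallP ra; apply/ffunP => -[h k]; rewrite ffunE; apply: val_inj => /=.
  by have := ra h; rewrite sum_nat_eq0 => /forallP/(_ k)/eqP.
have c0 : has_cols m [ffun=> ord0] = [forall k, m k == 0%N].
  apply: eq_forallb => k; rewrite big1 1?eq_sym// => h _; by rewrite ffunE.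
rewrite /table_sum; case: ifPn => hm.
  rewrite (big_pred1 [ffun=> ord0]) => [|a].
    rewrite /weight big1// => h _; rewrite big1// => k _.
    by rewrite ffunE expr0 fact0 divr1.
  by apply/idP/eqP => [/andP[/ra]//|->]; rewrite r0 c0.
rewrite big_pred0// => a; apply/negP => /andP[/ra ->].
by rewrite c0 (negPf hm).
Qed.

End tables.

(** * The index set of the sum *)

Section index_bounds.
Context {p : nat}.
Implicit Types (n m : 'I_p -> nat) (a : 'I_p -> 'I_p -> nat).

Lemma sum_Posz (I : finType) (P : pred I) (F : I -> nat) :
  \sum_(i | P i) (F i)%:Z = (\sum_(i | P i) F i)%N%:Z.
Proof. by rewrite (big_morph Posz PoszD (erefl _)). Qed.

Lemma sum_cell a (P : rel 'I_p) i j : P i j ->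
  (\sum_(h < p) \sum_(k < p | P h k) a h k =
   a i j + \sum_(h < p) \sum_(k < p | P h k && ((h, k) != (i, j))) a h k)%N.
Proof.
by move=> Pij; rewrite !pair_big_dep (bigD1 (i, j)).
Qed.

(** Moving the subtracted terms across and adding the cell [(i, j)] back to the rectangle gives an
    inequality of natural numbers. *)
Lemma l_boundE n m a i j : (l_bound n m a i j <= (a i j)%:Z) =
  (\sum_(h < p | h <= i) n h <= \sum_(h < p | j < h) m h +
     \sum_(h < p) \sum_(k < p | (h <= i) && (k <= j)) a h k)%N.
Proof.
rewrite (@sum_cell a (fun h k : 'I_p => (h <= i) && (k <= j))%N i j) ?leqnn//.
rewrite /l_bound ge_max lez_nat leq0n /= !sum_Posz.
under [X in _ - X]eq_bigr do rewrite sum_Posz.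
rewrite sum_Posz -lez_nat !PoszD.
under [X in _ = (_ <= _ + (_ + Posz X))]eq_bigr do under eq_bigl do rewrite -andbA.
by rewrite lerBlDr lerBlDl; congr (_ <= _); ring.
Qed.

Lemma L_boundE n m a i j : ((a i j)%:Z <= L_bound n m a i j) =
  (\sum_(h < p | h <= j) a i h <= n i)%N && (\sum_(h < p | h <= i) a h j <= m j)%N.
Proof.
rewrite /L_bound le_min !sum_Posz !lerBrDr -!PoszD !lez_nat.
have E (F : 'I_p -> nat) (x : 'I_p) :
    (\sum_(h < p | h <= x) F h = F x + \sum_(h < p | h < x) F h)%N.
  rewrite (bigD1 x)//=; congr addn; apply: eq_bigl => h.
  by rewrite [RHS]ltn_neqAle andbC.
by rewrite (E (a i)) (E (fun h => a h j)).
Qed.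

End index_bounds.

(** The upper bounds in the last column and the last row bound the row and column sums; the lower
    bound in the last corner makes the total at least [\sum_i n i], which forces equality in every
    row. *)
Lemma in_I_rows (p : nat) (n m : 'I_p -> nat) (a : 'I_p -> 'I_p -> nat) : in_I n m a ->
  (forall i, \sum_k a i k = n i)%N /\ (forall j, \sum_h a h j <= m j)%N.
Proof.
case: p n m a => [|q] n m a; first by split; case.
move=> /forallP H.
have HL i j : (a i j)%:Z <= L_bound n m a i j.
  by have /forallP/(_ j)/andP[] := H i.
have full (F : 'I_q.+1 -> nat) :
    (\sum_(h < q.+1 | h <= (ord_max : 'I_q.+1)) F h = \sum_h F h)%N.
  by apply: eq_bigl => h; rewrite /= -ltnS ltn_ord.
have rle i : (\sum_k a i k <= n i)%N.
  by have := HL i ord_max; rewrite L_boundE full => /andP[].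
split; last first.
  by move=> j; have := HL ord_max j; rewrite L_boundE full => /andP[].
have /forallP/(_ ord_max)/andP[+ _] := H ord_max.
rewrite l_boundE full [X in (X + _)%N]big_pred0 ?add0n; last first.
  by move=> h; rewrite /= ltnNge -ltnS ltn_ord.
have -> : (\sum_(h < q.+1)
    \sum_(k < q.+1 | (h <= (ord_max : 'I_q.+1)) && (k <= (ord_max : 'I_q.+1))) a h k =
  \sum_h \sum_k a h k)%N.
  apply: eq_bigr => h _; apply: eq_bigl => k.
  by rewrite /= -ltnS ltn_ord -ltnS ltn_ord.
have := leqif_sum (fun i (_ : xpredT i) => leqif_eq (rle i)).
move=> /geq_leqif -> /forallP h i; exact/eqP/h.
Qed.

Section index_set.
Context {R : realType} {p : nat}.
Implicit Types (n m : 'I_p -> nat) (a : 'I_p -> 'I_p -> nat).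

(** Of the total of the rows up to [i], the part in columns beyond [j] is at most the sum of [m]
    over those columns, and the rest is the rectangle of the lower bound. *)
Lemma rows_cols_in_I n m a : (forall i, \sum_k a i k = n i)%N ->
  (forall j, \sum_h a h j = m j)%N -> in_I n m a.
Proof.
move=> rn cm; apply/forallP => i; apply/forallP => j.
rewrite l_boundE L_boundE -rn -cm.
have sub (F : 'I_p -> nat) (P : pred 'I_p) : (\sum_(h | P h) F h <= \sum_h F h)%N.
  by rewrite [leqRHS](bigID P)/= leq_addr.
rewrite !sub !andbT.
under eq_bigr do rewrite -rn.
under [X in (_ <= X + _)%N]eq_bigr do rewrite -cm.
rewrite exchange_big /= [X in (_ <= X + _)%N](_ : _ =
   \sum_(k < p | j < k) \sum_h a h k)%N//.
rewrite (bigID (fun k : 'I_p => (j < k)%N))/=; apply: leq_add.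
  by apply: leq_sum => k _; exact: sub.
rewrite exchange_big big_mkcond /=; apply: leq_sum => h _.
case: (h <= i)%N => //=.
by apply: eq_leq; apply: eq_bigl => k; rewrite -leqNgt.
Qed.

(** * The block condition and the vanishing terms *)

Variables (S : 'M[R[i]]_p).

Lemma adjM_M n m x y : adjM S n m x y -> (x \in Mset m) && (y \in Mset m).
Proof. by move=> /existsP[h /andP[_]]; rewrite !inE => /andP[/andP[-> _] /andP[-> _]]. Qed.

Lemma adjM_sym n m : connect_sym (adjM S n m).
Proof.
apply: sym_connect_sym => x y; apply: eq_existsb => h.
by congr (_ && _); rewrite andbC.
Qed.

Lemma connect_M n m x y : connect (adjM S n m) x y -> x \in Mset m -> y \in Mset m.
Proof.
move=> /connectP[s + ->]; elim: s x => //= z s IH x /andP[xz zs] _.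
by apply: IH zs _; case/andP: (adjM_M xz).
Qed.

(** Each row in [N] is assigned to the unique block that contains its nonempty set [SN]; splitting
    both sums by blocks reduces the claim to the block identities. *)
Lemma block_total n m :
  (forall k, k \in Mset m ->
     \sum_(i < p | (i \in Nset n) && (SN S m i \subset block S n m k)) n i
     = \sum_(j < p | j \in block S n m k) m j)%N ->
  (forall i, i \in Nset n -> SN S m i != finset.set0) ->
  (\sum_i n i = \sum_j m j)%N.
Proof.
move=> hyp SN0; set e := adjM S n m in hyp *.
have esym : connect_sym e := @adjM_sym n m.
(* Blocks are indexed by the canonical representatives of the components that lie in [M]. *)
pose Q r := (r \in Mset m) && (fingraph.root e r == r).
have QM x : x \in Mset m -> Q (fingraph.root e x).
  move=> xM; rewrite /Q fingraph.root_root ?eqxx ?andbT//.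
  by apply: connect_M xM; exact: fingraph.connect_root.
(* The default [i] is not reached for [i] in [N], where [SN] is nonempty. *)
pose f i := if [pick k in SN S m i] is Some k then fingraph.root e k else i.
have fP i r : i \in Nset n -> Q r -> (SN S m i \subset block S n m r) = (f i == r).
  move=> iN /andP[rM /eqP rr]; rewrite /f.
  case: pickP => [k kS|]; last first.
    by move=> h; have /set0Pn[k] := SN0 i iN; rewrite h.
  have kM : k \in Mset m by move: kS; rewrite inE => /andP[].
  apply/fintype.subsetP/eqP => [/(_ k kS)|kr k' kS'].
    by rewrite inE => /andP[_]; rewrite -(root_connect esym) rr => /eqP.
  rewrite inE -(root_connect esym) rr -kr (root_connect esym).
  move: (kS'); rewrite inE => /andP[-> _] /=.
  (* Any two elements of the same [SN] are adjacent, so one of them decides the block. *)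
  by apply: connect1; apply/existsP; exists i; rewrite iN kS kS'.
transitivity (\sum_(i in Nset n) n i)%N.
  rewrite [LHS](bigID (mem (Nset n)))/= [X in (_ + X)%N]big1 ?addn0//.
  by move=> i; rewrite inE negbK => /eqP.
rewrite (partition_big f Q)/=; last first.
  move=> i iN; rewrite /f; case: pickP => [k kS|].
    by apply: QM; move: kS; rewrite inE => /andP[].
  by move=> h; have /set0Pn[k] := SN0 i iN; rewrite h.
transitivity (\sum_(j in Mset m) m j)%N; last first.
  rewrite [RHS](bigID (mem (Mset m)))/= [X in _ = (_ + X)%N]big1 ?addn0//.
  by move=> i; rewrite inE negbK => /eqP.
rewrite [RHS](partition_big (fingraph.root e) Q)//=.
apply: eq_bigr => r Qr; have /andP[rM /eqP rr] := Qr.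
transitivity (\sum_(i < p | (i \in Nset n) && (SN S m i \subset block S n m r)) n i)%N.
  by apply: eq_bigl => i; case: (boolP (i \in Nset n)) => //= iN; rewrite fP.
rewrite hyp//; apply: eq_bigl => j.
by rewrite inE -(root_connect esym) rr eq_sym.
Qed.

(** The two index sets differ only in terms that vanish, so the sums are compared term by term. *)
Lemma sum_over_I_tables n m :
  (forall k, k \in Mset m ->
     \sum_(i < p | (i \in Nset n) && (SN S m i \subset block S n m k)) n i
     = \sum_(j < p | j \in block S n m k) m j)%N ->
  sum_over_I n m (Pi_term S n m) =
  (\prod_(h < p) ((n h)`! * (m h)`!)%:R) * table_sum S (\sum_i n i)%N n m.
Proof.
move=> hyp; rewrite /sum_over_I /Pi_term -mulr_sumr; congr (_ * _).
rewrite /table_sum big_mkcond [RHS]big_mkcond /=; apply: eq_bigr => a _.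
rewrite -/(weight S a).
have le_sum (F : 'I_p -> nat) i : (F i <= \sum_h F h)%N.
  by rewrite (bigD1 i)//= leq_addr.
case: ifPn => ia; case: ifPn => // rc.
- have [rn cm] := in_I_rows ia.
  apply/eqP; apply: contraNT rc => w0.
  have cell h k : (0 < a (h, k))%N -> S h k != 0.
    move=> ahk; apply: contra w0 => /eqP S0.
    rewrite /weight (bigD1 h)//= (bigD1 k)//= S0 expr0n.
    by rewrite eqn0Ngt ahk /= !mul0r.
  (* A nonzero row sum yields a positive cell, and a positive cell of a nonzero term witnesses that
     [SN] of that row is nonempty. *)
  have tot : (\sum_i n i = \sum_j m j)%N.
    apply: block_total hyp _ => i; rewrite inE -rn sum_nat_eq0.
    move=> /forallPn[k]; rewrite /= -lt0n => aik.
    apply/set0Pn; exists k; rewrite !inE cell// andbT.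
    rewrite -lt0n; apply: leq_trans aik _; apply: leq_trans (cm k).
    exact: (le_sum (fun h => a (h, k) : nat) i).
  apply/andP; split; apply/forallP => i; first by rewrite rn.
  (* The column sums are at most [m] and have the same total, hence equal [m]. *)
  have := leqif_sum (fun i (_ : xpredT i) => leqif_eq (cm i)).
  have -> : (\sum_i \sum_h a (h, i) = \sum_i m i)%N.
    by rewrite exchange_big /= -tot; apply: eq_bigr => h _; rewrite rn.
  by move=> /geq_leqif; rewrite leqnn => /esym/forallP/(_ i).
- move: rc ia => /andP[/forallP ra /forallP ca].
  rewrite rows_cols_in_I// => i; apply/eqP; [exact: ra|exact: ca].
Qed.

End index_set.

(** * Gaussian integration by parts *)

Section complex_gaussian_functional.
Context {R : realType} (K : nat).
Local Notation C := R[i].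
Local Notation mu := (@lebesgue_measure R).
Implicit Types (F G : (nat -> R) -> C).

Definition citer F : C :=
  Complex (iter_integral K (fun x => complex.Re (F x)))
          (iter_integral K (fun x => complex.Im (F x))).

Definition citerable F :=
  iter_integrable K (fun x => complex.Re (F x)) /\
  iter_integrable K (fun x => complex.Im (F x)).

Lemma citer_linear F G (a b : C) : citerable F -> citerable G ->
  citerable (fun x => a * F x + b * G x) /\
  citer (fun x => a * F x + b * G x) = a * citer F + b * citer G.
Proof.
case: a b => [ar ai] [br bi] [rF iF] [rG iG].
have ReE : (fun x => complex.Re (Complex ar ai * F x + Complex br bi * G x)) =
    (fun x => 1 * (ar * complex.Re (F x) + (- ai) * complex.Im (F x)) +
              1 * (br * complex.Re (G x) + (- bi) * complex.Im (G x))).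
  by apply/funext => x; case: (F x) (G x) => [u v] [w y] /=; ring.
have ImE : (fun x => complex.Im (Complex ar ai * F x + Complex br bi * G x)) =
    (fun x => 1 * (ar * complex.Im (F x) + ai * complex.Re (F x)) +
              1 * (br * complex.Im (G x) + bi * complex.Re (G x))).
  by apply/funext => x; case: (F x) (G x) => [u v] [w y] /=; ring.
have [i1 e1] := iter_linear ar (- ai) rF iF.
have [i2 e2] := iter_linear br (- bi) rG iG.
have [i3 e3] := iter_linear ar ai iF rF.
have [i4 e4] := iter_linear br bi iG rG.
have [i5 e5] := iter_linear 1 1 i1 i2.
have [i6 e6] := iter_linear 1 1 i3 i4.
rewrite /citerable /citer ReE ImE; split => //.
rewrite e5 e6 e1 e2 e3 e4; apply/eqP; rewrite eq_complex /=.
by apply/andP; split; apply/eqP; ring.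
Qed.

Variable d : nat -> R.
Hypothesis d_gt0 : forall i, (i < K)%N -> 0 < d i.

Definition gauss (x : nat -> R) : R := \prod_(i < K) expR (- (d i * x i ^+ 2)).

Definition gauss_citer F : C := citer (fun x => F x * (gauss x)%:C%C).
Definition gauss_citerable F := citerable (fun x => F x * (gauss x)%:C%C).

Lemma gauss_citer_linear F G (a b : C) : gauss_citerable F -> gauss_citerable G ->
  gauss_citerable (fun x => a * F x + b * G x) /\
  gauss_citer (fun x => a * F x + b * G x) = a * gauss_citer F + b * gauss_citer G.
Proof.
move=> iF iG; have := citer_linear a b iF iG; rewrite /gauss_citerable /gauss_citer.
rewrite (_ : (fun x => _) = (fun x => (a * F x + b * G x) * (gauss x)%:C%C))//.
by apply/funext => x; ring.
Qed.

Definition mono (e : 'I_K -> nat) (x : nat -> R) : R := \prod_(i < K) x i ^+ e i.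

Definition gmoment (e : 'I_K -> nat) : R :=
  \prod_(i < K) Rintegral mu setT (mono_gauss (d i) (e i)).

Lemma gauss_citer_mono e : gauss_citerable (fun x => (mono e x)%:C%C) /\
  gauss_citer (fun x => (mono e x)%:C%C) = (gmoment e)%:C%C.
Proof.
pose f (i : nat) : R -> R :=
  if insub i is Some j then mono_gauss (d (j : 'I_K)) (e j) else cst 0.
have fE (i : 'I_K) : f i = mono_gauss (d i) (e i) by rewrite /f valK.
have intf i : (i < K)%N -> mu.-integrable setT (EFin \o f i).
  by move=> iK; rewrite (fE (Ordinal iK)); exact/integrable_mono_gauss/d_gt0.
have [h1 h2] := iter_prod intf.
have [h3 h4] := iter_linear 0 0 h1 h1.
have ReE : (fun x => complex.Re ((mono e x)%:C%C * (gauss x)%:C%C)) =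
    (fun x : nat -> R => \prod_(i < K) f i (x i)).
  apply/funext => x /=; rewrite mulr0 subr0 /mono /gauss -big_split /=.
  by apply: eq_bigr => i _; rewrite fE.
have ImE : (fun x => complex.Im ((mono e x)%:C%C * (gauss x)%:C%C)) =
    (fun x : nat -> R => 0 * (\prod_(i < K) f i (x i)) + 0 * (\prod_(i < K) f i (x i))).
  by apply/funext => x /=; ring.
rewrite /gauss_citerable /gauss_citer /citerable /citer ReE ImE; split => //.
rewrite h2 h4 !mul0r addr0 /gmoment; congr Complex.
by apply: eq_bigr => i _; rewrite fE.
Qed.

Lemma gauss_citer0 : gauss_citerable (fun=> 0) /\ gauss_citer (fun=> 0) = 0.
Proof.
have [h1 _] := gauss_citer_mono (fun=> 0%N).
have := gauss_citer_linear 0 0 h1 h1.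
by under eq_fun do rewrite !mul0r addr0; rewrite !mul0r addr0.
Qed.

Lemma gauss_citer_sum (I : finType) (F : I -> (nat -> R) -> C) (a : I -> C) :
  (forall i, gauss_citerable (F i)) ->
  gauss_citerable (fun x => \sum_i a i * F i x) /\
  gauss_citer (fun x => \sum_i a i * F i x) = \sum_i a i * gauss_citer (F i).
Proof.
move=> iF.
suff H (s : seq I) : gauss_citerable (fun x => \sum_(i <- s) a i * F i x) /\
  gauss_citer (fun x => \sum_(i <- s) a i * F i x) = \sum_(i <- s) a i * gauss_citer (F i).
  exact: H.
elim: s => [|i s [h1 h2]].
  by under eq_fun do rewrite big_nil; rewrite big_nil; exact: gauss_citer0.
under eq_fun do rewrite big_cons -[\sum_(j <- s) _]mul1r.
rewrite big_cons -[\sum_(j <- s) _]mul1r -h2.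
exact: gauss_citer_linear.
Qed.

Lemma mono_incr e i x : mono (incr e i) x = x i * mono e x.
Proof.
rewrite /mono (bigD1 i)//= [in RHS](bigD1 i)//= /incr eqxx addn1 exprS mulrA.
by congr (_ * _); apply: eq_bigr => j /negPf ->; rewrite addn0.
Qed.

Lemma gmoment_incr e i :
  gmoment (incr e i) = (2 * d i)^-1 * ((e i)%:R * gmoment (decr e i)).
Proof.
rewrite /gmoment (bigD1 i)//= [in RHS](bigD1 i)//= /incr /decr eqxx addn1.
rewrite Rintegral_mono_gaussS ?d_gt0// subn1 !mulrA; congr (_ * _ * _).
  by rewrite mulrC.
by apply: eq_bigr => j /negPf ->; rewrite addn0 subn0.
Qed.

(** * Stein's identity and the Wick recursion for linear forms *)

Context {T : finType}.
Variable z : T -> 'I_K -> C.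
Implicit Types (c : T -> nat) (e : 'I_K -> nat) (t u : T).

Definition linform t (x : nat -> R) : C := \sum_i z t i * (x i)%:C%C.
Definition linprod c x : C := \prod_t linform t x ^+ c t.
(** Keeping a coordinate monomial beside the linear forms lets these be expanded into coordinates
    one at a time. *)
Definition mono_linprod e c x : C := (mono e x)%:C%C * linprod c x.

Lemma linprod_incr c t x : linprod (incr c t) x = linform t x * linprod c x.
Proof.
rewrite /linprod (bigD1 t)//= [in RHS](bigD1 t)//= /incr eqxx addn1 exprS mulrA.
by congr (_ * _); apply: eq_bigr => j /negPf ->; rewrite addn0.
Qed.

Lemma mono_linprod_incr e c t :
  mono_linprod e (incr c t) = fun x => \sum_i z t i * mono_linprod (incr e i) c x.
Proof.
apply/funext => x; rewrite /mono_linprod linprod_incr mulrCA /linform mulr_suml.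
by apply: eq_bigr => i _; rewrite mono_incr rmorphM /=; ring.
Qed.

Lemma mono_linprod0 e : mono_linprod e (fun=> 0%N) = fun x => (mono e x)%:C%C.
Proof.
by apply/funext => x; rewrite /mono_linprod /linprod big1 ?mulr1.
Qed.

Lemma gauss_citerable_mono_linprod e c : gauss_citerable (mono_linprod e c).
Proof.
elim/(@multiplicity_ind T): c e => [|c t IH] e.
  by rewrite mono_linprod0; case: (gauss_citer_mono e).
by rewrite mono_linprod_incr; have [] := gauss_citer_sum (z t) (fun i => IH (incr e i)).
Qed.

Lemma gauss_citer_mono_linprod_incr e c t :
  gauss_citer (mono_linprod e (incr c t)) =
  \sum_i z t i * gauss_citer (mono_linprod (incr e i) c).
Proof.
rewrite mono_linprod_incr.
by have [_ ->] := gauss_citer_sum (z t) (fun i => gauss_citerable_mono_linprod (incr e i) c).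
Qed.

(** Stein's identity: under the Gaussian integral, multiplying by [x_i] amounts to [(2 d_i)^-1]
    times differentiating in [x_i]. Induction on [c] for all [e] expands one linear form at a time,
    down to monomials, where this is the one-dimensional recursion. *)
Lemma gauss_citer_stein e c i :
  gauss_citer (mono_linprod (incr e i) c) = ((2 * d i)^-1)%:C%C *
    ((e i)%:R * gauss_citer (mono_linprod (decr e i) c) +
     \sum_t (c t)%:R * z t i * gauss_citer (mono_linprod e (decr c t))).
Proof.
elim/(@multiplicity_ind T): c e => [|c s IH] e.
  rewrite big1 ?addr0 => [|t _]; last by rewrite !mul0r.
  rewrite !mono_linprod0 !(proj2 (gauss_citer_mono _)) gmoment_incr.
  by rewrite !rmorphM /= rmorph_nat.
rewrite gauss_citer_mono_linprod_incr.
under eq_bigr do rewrite incrC IH.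
under [X in _ = _ * (_ + X)]eq_bigr => t _.
  rewrite mulrAC (decr_incr_split (fun c => gauss_citer (mono_linprod e c))) mulrDl.
  over.
rewrite gauss_citer_mono_linprod_incr big_split /=.
have -> : \sum_t (t == s)%:R * gauss_citer (mono_linprod e c) * z t i =
    z s i * gauss_citer (mono_linprod e c).
  rewrite (bigD1 s)//= eqxx mul1r mulrC big1 ?addr0// => t /negPf ->.
  by rewrite !mul0r.
under [X in _ = _ * (_ + (X + _))]eq_bigr do rewrite gauss_citer_mono_linprod_incr.
(* Expanding the form [s] also differentiates its new coordinate; this excess [z s i] term cancels
   the one that the Leibniz rule for the forms produced. *)
have -> : (e i)%:R * (\sum_j z s j * gauss_citer (mono_linprod (incr (decr e i) j) c)) =
   \sum_j z s j * ((incr e j i)%:R * gauss_citer (mono_linprod (decr (incr e j) i) c))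
   - z s i * gauss_citer (mono_linprod e c).
  under [in RHS]eq_bigr do
    rewrite (decr_incr_split (fun e => gauss_citer (mono_linprod e c))) mulrDr.
  rewrite big_split /= mulr_sumr.
  have -> : \sum_j z s j * ((i == j)%:R * gauss_citer (mono_linprod e c)) =
      z s i * gauss_citer (mono_linprod e c).
    rewrite (bigD1 i)//= eqxx mul1r big1 ?addr0// => j /negPf ji.
    by rewrite eq_sym ji mul0r mulr0.
  by rewrite addrK; apply: eq_bigr => j _; rewrite mulrCA.
rewrite addrACA addNr addr0.
under eq_bigr do rewrite mulrCA.
rewrite -mulr_sumr; congr (_ * _).
rewrite (eq_bigr _ (fun j _ => mulrDr _ _ _)) big_split /=; congr (_ + _).
rewrite (eq_bigr _ (fun j _ => mulr_sumr _ _ _ _)).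
rewrite exchange_big /=; apply: eq_bigr => t _.
rewrite mulr_sumr mulr_suml; apply: eq_bigr => j _; ring.
Qed.

(** The covariance without conjugation: coordinate [i] has variance [1 / (2 d_i)] under the
    normalized weight. *)
Definition cov t u : C := \sum_i z t i * z u i * ((2 * d i)^-1)%:C%C.

(** Expand the form [t] in coordinates and apply Stein's identity with the constant monomial, so
    that only linear forms are differentiated. *)
Lemma gauss_citer_wick c t :
  gauss_citer (linprod (incr c t)) =
  \sum_u (c u)%:R * cov t u * gauss_citer (linprod (decr c u)).
Proof.
have E c' : linprod c' = mono_linprod (fun=> 0%N) c'.
  by apply/funext => x; rewrite /mono_linprod /mono big1// mul1r.
rewrite !E gauss_citer_mono_linprod_incr.
under eq_bigr do rewrite gauss_citer_stein mul0r add0r mulrA mulr_sumr.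
rewrite exchange_big /=; apply: eq_bigr => u _.
rewrite E /cov mulr_sumr mulr_suml; apply: eq_bigr => i _; ring.
Qed.

Lemma gauss_citer1 : gauss_citer (linprod (fun=> 0%N)) =
  (\prod_(i < K) Num.sqrt (pi / d i))%:C%C.
Proof.
have -> : linprod (fun=> 0%N) = fun x => (mono (fun=> 0%N) x)%:C%C.
  by apply/funext => x; rewrite /linprod /mono !big1.
rewrite (proj2 (gauss_citer_mono _)); congr (_%:C%C).
by apply: eq_bigr => i _; rewrite Rintegral_mono_gauss0// d_gt0.
Qed.

End complex_gaussian_functional.

(** * Moments of the complex normal distribution *)

Lemma big_double (V : Type) (idx : V) (op : Monoid.law idx) (p : nat) (f : nat -> V) :
  \big[op/idx]_(i < 2 * p) f i =
  \big[op/idx]_(j < p) op (f (2 * j)%N) (f (2 * j).+1).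
Proof.
elim: p => [|p IH]; first by rewrite !big_ord0.
rewrite (_ : (2 * p.+1)%N = (2 * p).+2); last by lia.
by rewrite !big_ord_recr /= IH Monoid.mulmA.
Qed.

Lemma conj_real {R : realType} (r : R) : Num.conj (r%:C%C) = r%:C%C.
Proof. by apply/eqP; rewrite eq_complex /= oppr0 !eqxx. Qed.

Section complex_normal_moments.
Context {R : realType} {p : nat}.
Local Notation C := R[i].
Variables (S L : 'M[C]_p) (s : 'rV[R]_p).
Hypothesis s_gt0 : forall i, 0 < s 0 i.
Hypothesis L_trig : forall i j : 'I_p, (j < i)%N -> L i j = 0.
Hypothesis L_diag : forall i, L i i = 1.
Hypothesis S_ldl : S = L *m diag_mx (map_mx (real_complex R) s) *m conjT L.

(** Both real coordinates of [w_j] carry the coefficient [1 / s_j] in the exponent obtained from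
    [z = L w]. *)
Let dcoef (i : nat) : R := if insub i./2 is Some j then (s 0 (j : 'I_p))^-1 else 1.

Let dcoef_gt0 i : (i < 2 * p)%N -> 0 < dcoef i.
Proof. by move=> _; rewrite /dcoef; case: insubP => // j _ _; rewrite invr_gt0. Qed.

Let half_even (j : nat) : (2 * j)./2 = j. Proof. lia. Qed.
Let half_odd (j : nat) : (2 * j).+1./2 = j. Proof. lia. Qed.
Let odd_even (j : nat) : odd (2 * j) = false. Proof. lia. Qed.

Let dcoef_even (j : 'I_p) : dcoef (2 * j)%N = (s 0 j)^-1.
Proof. by rewrite /dcoef half_even valK. Qed.
Let dcoef_odd (j : 'I_p) : dcoef (2 * j).+1 = (s 0 j)^-1.
Proof. by rewrite /dcoef half_odd valK. Qed.

(** Coefficient of the real coordinate [i] in [(L w)_h]: coordinates [2j] and [2j+1] are the real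
    and imaginary parts of [w_j], whence the imaginary unit at odd [i]. *)
Let zrow (h : 'I_p) (i : nat) : C :=
  (if insub i./2 is Some j then L h (j : 'I_p) else 0) *
  (if odd i then Complex 0 1 else 1).

Let zrow_even h (j : 'I_p) : zrow h (2 * j)%N = L h j.
Proof. by rewrite /zrow half_even valK odd_even mulr1. Qed.
Let zrow_odd h (j : 'I_p) : zrow h (2 * j).+1 = L h j * Complex 0 1.
Proof. by rewrite /zrow half_odd valK /= odd_even. Qed.

(** [inl h] stands for [z_h] and [inr h] for its conjugate. *)
Let zform (t : 'I_p + 'I_p) (i : 'I_(2 * p)) : C :=
  match t with inl h => zrow h i | inr h => Num.conj (zrow h i) end.

Let expo (n m : 'I_p -> nat) (t : 'I_p + 'I_p) : nat :=
  match t with inl h => n h | inr h => m h end.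

Lemma linform_inl h x : linform zform (inl h) x = (L *m cvec_of p x) h 0.
Proof.
rewrite /linform /= (big_double _ _ (fun i => zrow h i * (x i)%:C%C)) mxE.
apply: eq_bigr => j _; rewrite /= zrow_even zrow_odd !mxE.
rewrite -mulrA -mulrDr; congr (_ * _).
by apply/eqP; rewrite eq_complex /=; apply/andP; split; apply/eqP; ring.
Qed.

Lemma linform_inr h x : linform zform (inr h) x = Num.conj (linform zform (inl h) x).
Proof.
rewrite /linform rmorph_sum; apply: eq_bigr => i _.
by rewrite rmorphM /= conj_real.
Qed.

(** The imaginary coordinate enters with the square [-1] of the imaginary unit and cancels the real
    one. *)
Lemma cov_same h k : cov dcoef zform (inl h) (inl k) = 0.
Proof.
rewrite /cov /= (big_double _ _ (fun i => zrow h i * zrow k i * ((2 * dcoef i)^-1)%:C%C)).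
apply: big1 => j _; rewrite /= !zrow_even !zrow_odd dcoef_even dcoef_odd -mulrDl.
rewrite (_ : _ + _ = 0) ?mul0r// mulrACA.
rewrite (_ : Complex 0 1 * Complex 0 1 = -1 :> C) ?mulrN1 ?subrr//.
by apply/eqP; rewrite eq_complex /=; apply/andP; split; apply/eqP; ring.
Qed.

Lemma cov_conj h k : cov dcoef zform (inr h) (inr k) = 0.
Proof.
rewrite -[RHS](rmorph0 Num.conj) -(cov_same h k) /cov rmorph_sum.
by apply: eq_bigr => i _; rewrite [RHS]rmorphM [X in _ = X * _]rmorphM /= conj_real.
Qed.

(** Here the imaginary unit meets its conjugate, so the two coordinates add up to
    [s_j * L h j * conj (L k j)], a term of the entry of [L diag(s) L^*]. *)
Lemma cov_cross h k : cov dcoef zform (inl h) (inr k) = S h k.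
Proof.
rewrite /cov /= (big_double _ _
  (fun i => zrow h i * Num.conj (zrow k i) * ((2 * dcoef i)^-1)%:C%C)).
rewrite S_ldl mxE; apply: eq_bigr => j _.
rewrite /= mul_mx_diag !mxE !zrow_even !zrow_odd dcoef_even dcoef_odd -mulrDl.
rewrite rmorphM /= mulrACA.
rewrite (_ : Complex 0 1 * Num.conj (Complex 0 1) = 1 :> C); last first.
  by apply/eqP; rewrite eq_complex /=; apply/andP; split; apply/eqP; ring.
rewrite mulr1.
have -> : (s 0 j)%:C%C = 2 * ((2 * (s 0 j)^-1)^-1)%:C%C.
  rewrite -(rmorph_nat (real_complex R)) -rmorphM /=; congr _%:C%C.
  by field; rewrite gt_eqF.
ring.
Qed.


Lemma det_unitriangular (A : 'M[C]_p) : (forall i j : 'I_p, (j < i)%N -> A i j = 0) ->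
  (forall i, A i i = 1) -> \det A = 1.
Proof.
move=> tA dA; rewrite -det_tr det_trig; last first.
  by apply/is_trig_mxP => i j ij; rewrite mxE tA.
by apply: big1 => i _; rewrite mxE dA.
Qed.

Lemma det_L : \det L = 1.
Proof. exact: det_unitriangular. Qed.

Lemma det_conjT (A : 'M[C]_p) : \det (conjT A) = Num.conj (\det A).
Proof. by rewrite /conjT det_tr det_map_mx. Qed.

Lemma det_S : \det S = (\prod_j s 0 j)%:C%C.
Proof.
rewrite S_ldl !det_mulmx det_conjT det_L rmorph1 mul1r mulr1 det_diag rmorph_prod.
by apply: eq_bigr => j _; rewrite mxE.
Qed.

Lemma prod_s_gt0 : 0 < \prod_j s 0 j.
Proof. by apply: prodr_gt0 => j _. Qed.

Let quad (x : nat -> R) : R :=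
  \sum_(j < p) (s 0 j)^-1 * (x (2 * j)%N ^+ 2 + x (2 * j).+1 ^+ 2).

Lemma quad_S x :
  (conjT (L *m cvec_of p x) *m invmx S *m (L *m cvec_of p x)) 0 0 = (quad x)%:C%C.
Proof.
have S_unit : S \in unitmx.
  by rewrite unitmxE det_S unitfE eq_complex /= eqxx andbT gt_eqF// prod_s_gt0.
have L_unit : L \in unitmx by rewrite unitmxE det_L unitr1.
pose D := diag_mx (map_mx (real_complex R) s).
pose D' := diag_mx (map_mx (real_complex R) (\row_j (s 0 j)^-1)).
have DD' : D' *m D = 1%:M.
  apply/matrixP => i j; rewrite mul_diag_mx !mxE.
  case: eqVneq => [->|_]; last by rewrite !mulr0n mulr0.
  by rewrite !mulr1n -rmorphM /= mulVf// gt_eqF.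
have E : conjT L *m invmx S *m L = D'.
  have h : D *m (conjT L *m invmx S *m L) = 1%:M.
    apply: (can_inj (mulKmx L_unit)); rewrite mulmx1 !mulmxA -S_ldl.
    by rewrite mulmxV// mul1mx.
  by rewrite -[LHS]mul1mx -DD' -mulmxA h mulmx1.
rewrite conjT_mul -!mulmxA [conjT L *m _]mulmxA [conjT L *m _ *m _]mulmxA E.
rewrite mxE /quad rmorph_sum; apply: eq_bigr => j _.
rewrite mul_diag_mx !mxE.
by apply/eqP; rewrite eq_complex /=; apply/andP; split; apply/eqP; ring.
Qed.

Lemma gauss_quad x : gauss (2 * p) dcoef x = expR (- quad x).
Proof.
rewrite /gauss (big_double _ _ (fun i => expR (- (dcoef i * x i ^+ 2)))).
rewrite /quad -sumrN expR_sum; apply: eq_bigr => j _.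
by rewrite /= dcoef_even dcoef_odd -expRD; congr expR; ring.
Qed.

(** As [L] is upper unitriangular, row [j] of [L w - w] involves only later rows; each real
    coordinate is thus shifted by a function of the outer ones and [iter_shift] applies. *)
Lemma citer_change F :
  citer (2 * p) (fun x => F (cvec_of p x)) =
  citer (2 * p) (fun x => F (L *m cvec_of p x)).
Proof.
pose v x : 'cV[C]_p := L *m cvec_of p x - cvec_of p x.
pose sh i x : R := if insub i./2 is Some j then
  (if odd i then complex.Im (v x (j : 'I_p) 0) else complex.Re (v x j 0)) else 0.
have vE x j : v x j 0 = \sum_(k < p | (j < k)%N) L j k * cvec_of p x k 0.
  have diag : \sum_(k < p | ~~ (j < k)%N) L j k * cvec_of p x k 0 = cvec_of p x j 0.
    rewrite (bigD1 j) ?ltnn//= L_diag mul1r big1 ?addr0// => k /andP[jk kj].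
    by rewrite L_trig ?mul0r// ltn_neqAle kj leqNgt.
  have -> : v x j 0 = (L *m cvec_of p x) j 0 - cvec_of p x j 0 by rewrite !mxE.
  by rewrite mxE (bigID (fun k : 'I_p => (j < k)%N))/= diag addrK.
have sh_dep i x y : (forall j, (i < j < 2 * p)%N -> x j = y j) -> sh i x = sh i y.
  move=> xy; rewrite /sh; case: insubP => // j _ ji.
  suff -> : v x j 0 = v y j 0 by [].
  rewrite !vE; apply: eq_bigr => k jk; congr (_ * _); rewrite !mxE.
  (* As [j = i./2], [j < k] gives [2k > 2j+1 >= i]: the shift sees strictly later coordinates
     only. *)
  by congr Complex; apply: xy; move: ji jk (ltn_ord k) => /=; lia.
have E x : cvec_of p (fun i => if (i < 2 * p)%N then x i + sh i x else x i) =
    L *m cvec_of p x.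
  apply/matrixP => j o; rewrite ord1 mxE.
  have jp := ltn_ord j.
  rewrite !ifT; [|lia|lia].
  rewrite /sh half_even half_odd valK /= odd_even /=.
  rewrite -[RHS](subrK (cvec_of p x j 0)) [cvec_of p x j 0]mxE.
  rewrite (_ : (L *m cvec_of p x) j 0 - _ = v x j 0); last by rewrite !mxE.
  by case: (v x j 0) => a b; apply/eqP; rewrite eq_complex /= ![_ + x _]addrC !eqxx.
rewrite /citer; congr Complex; rewrite -[LHS](iter_shift _ sh_dep);
  by congr iter_integral; apply/funext => x; rewrite E.
Qed.

Let kappa : C := (((pi ^+ p)%:C)%C * \det S)^-1.

Lemma cmoment_gauss_citer n m :
  cmoment S n m = kappa * gauss_citer (2 * p) dcoef (linprod zform (expo n m)).
Proof.
rewrite /cmoment; set f : 'cV[C]_p -> C := (fun z => _ * _).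
rewrite -[LHS]/(citer (2 * p) (fun x => f (cvec_of p x))) citer_change {}/f.
have E : linprod zform (expo n m) = mono_linprod zform (fun=> 0%N) (expo n m).
  by apply/funext => x; rewrite /mono_linprod /mono big1// mul1r.
have hL := gauss_citerable_mono_linprod dcoef_gt0 zform (fun=> 0%N) (expo n m).
rewrite -E in hL.
have [_ e] := citer_linear kappa 0 hL hL.
rewrite mul0r addr0 in e; rewrite -e; congr citer; apply/funext => x.
rewrite mul0r addr0 /cnormal_density quad_S gauss_quad mulrA mulrC.
congr (_ * _); rewrite /linprod big_sumType /= -big_split /=; congr (_ * _).
apply: eq_bigr => j _.
by rewrite linform_inr linform_inl.
Qed.

(** The two coordinates of [w_j] contribute [sqrt (pi s_j)] each, so the total mass is [pi^p] times
    [\det S]. *)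
Lemma kappa_gauss_citer1 : kappa * gauss_citer (2 * p) dcoef (linprod zform (fun=> 0%N)) = 1.
Proof.
rewrite (gauss_citer1 dcoef_gt0) (big_double _ _ (fun i => Num.sqrt (pi / dcoef i))).
have -> : \prod_(j < p) (Num.sqrt (pi / dcoef (2 * j)%N) * Num.sqrt (pi / dcoef (2 * j).+1)) =
    pi ^+ p * \prod_j s 0 j.
  have -> : pi ^+ p = \prod_(j < p) (pi : R) by rewrite prodr_const card_ord.
  rewrite -big_split /=; apply: eq_bigr => j _.
  rewrite dcoef_even dcoef_odd invrK -expr2 sqr_sqrtr//.
  by rewrite mulr_ge0 ?pi_ge0// ltW.
rewrite /kappa det_S -rmorphM /= mulVf// eq_complex /= eqxx andbT gt_eqF//.
by rewrite mulr_gt0 ?prod_s_gt0// exprn_gt0// pi_gt0.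
Qed.

(** Without unconjugated forms, a conjugated one can only pair with another conjugated one, and
    [cov_conj] makes these pairings vanish. *)
Lemma gauss_citer_expo0 (m : 'I_p -> nat) : ~~ [forall k, m k == 0%N] ->
  gauss_citer (2 * p) dcoef (linprod zform (expo (fun=> 0%N) m)) = 0.
Proof.
move=> /forallPn[k]; rewrite -lt0n => mk.
have -> : expo (fun=> 0%N) m = incr (expo (fun=> 0%N) (decr m k)) (inr k).
  by apply/funext => -[h|h]; rewrite /incr //= -{1}(incr_decr mk).
rewrite (gauss_citer_wick dcoef_gt0) big_sumType /= !big1 ?addr0// => h _.
  by rewrite cov_conj mulr0 mul0r.
by rewrite !mul0r.
Qed.

Lemma gauss_citer_expo_incr n m h :
  gauss_citer (2 * p) dcoef (linprod zform (expo (incr n h) m)) =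
  \sum_k (m k)%:R * S h k * gauss_citer (2 * p) dcoef (linprod zform (expo n (decr m k))).
Proof.
have -> : expo (incr n h) m = incr (expo n m) (inl h).
  by apply/funext => -[i|i]; rewrite /incr //= addn0.
rewrite (gauss_citer_wick dcoef_gt0) big_sumType /= big1 ?add0r => [|i _]; last first.
  by rewrite cov_same mulr0 mul0r.
apply: eq_bigr => k _; rewrite cov_cross.
congr (_ * gauss_citer _ _ (linprod _ _)).
by apply/funext => -[i|i]; rewrite /decr //= subn0.
Qed.

(** Both sides satisfy the same recursion in [n] with the same initial values. The bound [B] is kept
    apart from [n] so that one type of tables serves the whole induction. *)
Lemma gauss_citer_expo_table B n m : (\sum_i n i <= B)%N ->
  kappa * gauss_citer (2 * p) dcoef (linprod zform (expo n m)) =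
  (\prod_(h < p) ((n h)`! * (m h)`!)%:R) * table_sum S B n m.
Proof.
elim/(@multiplicity_ind 'I_p): n m => [|n h IH] m nB.
  rewrite table_sum0; case: ifPn => hm; last first.
    by rewrite gauss_citer_expo0// !mulr0.
  have m0 k : m k = 0%N by exact/eqP/(forallP hm).
  rewrite (_ : expo _ m = fun=> 0%N); last by apply/funext => -[|].
  by rewrite kappa_gauss_citer1 mulr1 big1// => k _; rewrite m0.
rewrite sum_incr in nB.
rewrite gauss_citer_expo_incr mulr_sumr.
have facS : \prod_(i < p) (((incr n h) i)`! * (m i)`!)%:R =
   (\prod_(i < p) ((n i)`! * (m i)`!)%:R) * (n h).+1%:R :> C.
  rewrite (bigD1 h)//= [in RHS](bigD1 h)//= /incr eqxx addn1 factS.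
  rewrite (eq_bigr (fun i => ((n i)`! * (m i)`!)%:R)); last first.
    by move=> i /negPf ->; rewrite addn0.
  by rewrite !natrM; ring.
rewrite facS -mulrA table_sum_incr// mulr_sumr [RHS]big_mkcond /=.
apply: eq_bigr => k _; case: ifPn => [mk|]; last first.
  by rewrite -eqn0Ngt => /eqP ->; rewrite !mul0r mulr0.
rewrite mulrCA IH; last exact: ltnW.
rewrite !mulrA; congr (_ * _).
rewrite [RHS]mulrC mulrAC [S h k * _]mulrC; congr (_ * _).
(* The Wick factor [m k] restores [(m k)!] from [(m k - 1)!]. *)
rewrite (bigD1 k)//= [in RHS](bigD1 k)//= /decr eqxx mulrA; congr (_ * _).
  by rewrite -natrM mulnCA; case: (m k) mk => // q _; rewrite subn1 factS.
by apply: eq_bigr => i /negPf ->; rewrite subn0.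
Qed.

Lemma cmoment_table_sum n m :
  cmoment S n m =
  (\prod_(h < p) ((n h)`! * (m h)`!)%:R) * table_sum S (\sum_i n i) n m.
Proof. by rewrite cmoment_gauss_citer; exact: gauss_citer_expo_table. Qed.

End complex_normal_moments.

End wick.

Theorem theorem3p15 (R : realType) (p : nat) (Sigma : 'M[R[i]]_p)
    (n m : 'I_p -> nat) :
  hermitian_pd Sigma ->
  (forall k : 'I_p, k \in Mset m ->
     \sum_(i < p | (i \in Nset n) && (SN Sigma m i \subset block Sigma n m k)) n i
     = \sum_(j < p | j \in block Sigma n m k) m j) ->
  cmoment Sigma n m = sum_over_I n m (Pi_term Sigma n m).
Proof.
move=> /hermitian_pd_ldl[L [s [s0 tL dL EL]]] hyp.
by rewrite (sum_over_I_tables hyp) (cmoment_table_sum s0 tL dL EL).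
Qed.
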